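(* Let $X\subseteq\mathbb{R}^s$ be an open set, let $f=(f_1,\dots,f_n):X\to\mathbb{R}^n$ and $g=(g_1,\dots,g_m):X\to\mathbb{R}^m$ be Fréchet differentiable on $X$, let $S=\{x\in X\mid g(x)\leqq 0\}$, and consider the problem (P): minimize $f(x)$ subject to $x\in S$. Then the following two statements are equivalent: (i) for every Kuhn-Tucker stationary point $x\in S$ and for every multiplier $(\lambda,\mu)$ which satisfies the Kuhn-Tucker necessary optimality conditions together with $x$, the point $x$ is a global solution of the weighting problem $(\mathrm{P}_{\lambda})$ with the same vector $\lambda$; (ii) (P) is KT-invex.
   Context: For vectors $a,b$ of the same dimension: $a\leqq b$ means $a_i\le b_i$ for all $i$, and $a\geqq b$ means $b\leqq a$. The Jacobian matrix of $f$ at $x$ is $Jf(x)$, an $n\times s$ matrix with rows $\nabla f_i(x)$; $\lambda f(x)=\sum_{i=1}^n\lambda_i f_i(x)$. For $x\in S$, $I(x)=\{i\in\{1,\dots,m\}\mid g_i(x)=0\}$ is the set of active constraints. Kuhn-Tucker necessary optimality conditions: a multiplier $(\lambda,\mu)\in\mathbb{R}^n\times\mathbb{R}^m$ satisfies them together with $x\in S$ if $\lambda\geqq 0$, $\lambda\neq 0$, $\mu\geqq 0$, $\mu_i g_i(x)=0$ for $i=1,\dots,m$, and $\sum_{i=1}^n\lambda_i\nabla f_i(x)+\sum_{i\in I(x)}\mu_i\nabla g_i(x)=0$. A point $x\in S$ is a Kuhn-Tucker stationary point (KT point) if such a multiplier exists. Weighting problem $(\mathrm{P}_\lambda)$, for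 $\lambda\geqq 0$, $\lambda\ne 0$: minimize $\lambda f(x)$ subject to $x\in S$. A point $\bar x\in S$ is a global solution if $\lambda f(\bar x)\le\lambda f(x)$ for all $x\in S$. KT-invex: (P) is KT-invex if there exists a map $\eta:X\times X\to\mathbb{R}^s$ such that for all $x,y\in X$ with $g(x)\leqq 0$ and $g(y)\leqq 0$, one has $f(y)-f(x)\geqq Jf(x)\,\eta(x,y)$ and $0\ge\nabla g_j(x)\,\eta(x,y)$ for all $j\in I(x)$. *)

(* Defs.v *)
From mathcomp Require Import all_boot all_order all_algebra.
From mathcomp Require Import all_classical all_reals all_analysis.
Set Implicit Arguments.
Unset Strict Implicit.
Unset Printing Implicit Defensive.
Import Order.TTheory GRing.Theory Num.Theory.
Import numFieldNormedType.Exports.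
Local Open Scope classical_set_scope.
Local Open Scope ring_scope.

Definition lev (R : realType) (k : nat) (a b : 'rV[R]_k) : Prop :=
  forall i, a 0 i <= b 0 i.

Notation "a <=v b" := (lev a b) (at level 70, no associativity).

Definition dotv (R : realType) (k : nat) (a b : 'rV[R]_k) : R :=
  \sum_(i < k) a 0 i * b 0 i.

(* Since vectors are rows, the library's ['J h x] is the transpose of the
   usual Jacobian matrix. *)
Definition Jac (R : realType) (s k : nat) (h : 'rV[R]_s -> 'rV[R]_k)
    (x : 'rV[R]_s) : 'M[R]_(k, s) := ('J h x)^T.

Definition grad (R : realType) (s k : nat) (h : 'rV[R]_s -> 'rV[R]_k)
    (i : 'I_k) (x : 'rV[R]_s) : 'rV[R]_s := row i (Jac h x).

(* Below, f and g are total functions of which only the restriction to the open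
   set X matters. *)
Definition feasible (R : realType) (s m : nat) (X : set 'rV[R]_s)
    (g : 'rV[R]_s -> 'rV[R]_m) : set 'rV[R]_s :=
  [set x | X x /\ g x <=v 0].

Definition active (R : realType) (s m : nat) (g : 'rV[R]_s -> 'rV[R]_m)
    (x : 'rV[R]_s) : pred 'I_m := [pred i | g x 0 i == 0].

Definition KT_conditions (R : realType) (s n m : nat)
    (f : 'rV[R]_s -> 'rV[R]_n) (g : 'rV[R]_s -> 'rV[R]_m)
    (x : 'rV[R]_s) (lam : 'rV[R]_n) (mu : 'rV[R]_m) : Prop :=
  [/\ 0 <=v lam, lam <> 0, 0 <=v mu,
      forall i, mu 0 i * g x 0 i = 0
    & \sum_(i < n) lam 0 i *: grad f i x
      + \sum_(i in active g x) mu 0 i *: grad g i x = 0].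

Definition KT_point (R : realType) (s n m : nat) (X : set 'rV[R]_s)
    (f : 'rV[R]_s -> 'rV[R]_n) (g : 'rV[R]_s -> 'rV[R]_m)
    (x : 'rV[R]_s) : Prop :=
  feasible X g x /\ exists lam mu, KT_conditions f g x lam mu.

Definition weighting_global_solution (R : realType) (s n m : nat)
    (X : set 'rV[R]_s) (f : 'rV[R]_s -> 'rV[R]_n) (g : 'rV[R]_s -> 'rV[R]_m)
    (lam : 'rV[R]_n) (x : 'rV[R]_s) : Prop :=
  feasible X g x /\
  forall y, feasible X g y -> dotv lam (f x) <= dotv lam (f y).

Definition KT_invex (R : realType) (s n m : nat) (X : set 'rV[R]_s)
    (f : 'rV[R]_s -> 'rV[R]_n) (g : 'rV[R]_s -> 'rV[R]_m) : Prop :=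
  exists eta : 'rV[R]_s -> 'rV[R]_s -> 'rV[R]_s,
    forall x y, X x -> X y -> g x <=v 0 -> g y <=v 0 ->
      (Jac f x *m (eta x y)^T)^T <=v f y - f x /\
      forall j, j \in active g x -> dotv (grad g j x) (eta x y) <= 0.

(* Main.v *)
Require Import Defs.
From mathcomp Require Import all_boot all_order all_algebra.
From mathcomp Require Import all_classical all_reals all_analysis.
From mathcomp Require Import lra.
Set Implicit Arguments.
Unset Strict Implicit.
Unset Printing Implicit Defensive.
Import Order.TTheory GRing.Theory Num.Theory.
Import numFieldNormedType.Exports.
Local Open Scope classical_set_scope.
Local Open Scope ring_scope.

(** Fix feasible points x and y.  A value for eta x y is a solution v of the
    finite system of linear inequalities
      grad f_i x . v <= f_i y - f_i x  for all i,
      grad g_j x . v <= 0              for all active j.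
    By Gale's theorem of the alternative ([gale_alternative]) this system is
    solvable unless some nonnegative combination (lam, mu) of its left-hand
    sides vanishes while the same combination of the right-hand sides,
    lam . (f y - f x), is negative.  The vanishing combination is the Kuhn-Tucker
    equation at x, and the negativity both forces lam != 0 and says that y beats
    x in the weighting problem with weights lam.  So unsolvability at (x, y) is
    exactly a failure of (i) at x witnessed by y; choosing a solution for
    every pair yields eta.  The converse implication is the easy half of the
    alternative: combining the inequalities with weights (lam, mu) gives
    0 <= lam . (f y - f x).

    Gale's theorem is proved by Fourier-Motzkin elimination, by induction on the
    number of unknowns. *)

(** The pairwise compatibility conditions say that each upper bound
    [r i / c i] on t, with [c i > 0], dominates each lower bound [r j / c j],
    with [c j < 0]; the least upper bound, or else the greatest lower bound,
    is then a solution, and without bounds any t will do. *)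
Lemma one_unknown_system (R : realFieldType) (I : finType) (c r : I -> R) :
  (forall i, c i = 0 -> 0 <= r i) ->
  (forall i j, 0 < c i -> c j < 0 -> 0 <= c i * r j - c j * r i) ->
  exists t, forall i, c i * t <= r i.
Proof.
move=> r0 rPN.
have [[p cp]|noP] := pselect (exists i, 0 < c i).
  case: (arg_minP (P := fun i => 0 < c i) (fun i => r i / c i) cp) => q cq qmin.
  exists (r q / c q) => i.
  have [ci|ci|ci] := ltgtP (c i) 0; last by rewrite ci mul0r r0.
    have := rPN q i cq ci.
    rewrite mulrA ler_pdivrMr // [r i * _]mulrC; lra.
  by rewrite mulrC -ler_pdivlMr //; exact: qmin.
have [[p cp]|noN] := pselect (exists i, c i < 0).
  case: (arg_maxP (P := fun i => c i < 0) (fun i => r i / c i) cp) => q cq qmax.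
  exists (r q / c q) => i.
  have [ci|ci|ci] := ltgtP (c i) 0; last by rewrite ci mul0r r0.
    by rewrite mulrC -ler_ndivrMr //; exact: qmax.
  by case: noP; exists i.
exists 0 => i; rewrite mulr0.
have [ci|ci|/r0//] := ltgtP (c i) 0.
  by case: noN; exists i.
by case: noP; exists i.
Qed.

(** The row of multipliers by which the elimination step combines the given
    inequalities into the one indexed by the pair [p], where [c] lists the
    coefficients of the eliminated unknown: rows free of it are kept, rows of
    opposite signs are added so that it cancels, and the remaining pairs give
    0 <= 0. *)
Definition elimination_weight (R : realFieldType) (I : finType) (c : I -> R)
    (p : I * I) (i : I) : R :=
  if c p.1 == 0 then (i == p.1)%:R
  else if (0 < c p.1) && (c p.2 < 0)
  then c p.1 * (i == p.2)%:R - c p.2 * (i == p.1)%:R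
  else 0.

Lemma sum_delta (R : realFieldType) (I : finType) (i : I) (u : I -> R) :
  \sum_k (k == i)%:R * u k = u i.
Proof.
rewrite (bigD1 i) //= eqxx mul1r big1 ?addr0 // => k /negbTE ->.
by rewrite mul0r.
Qed.

Lemma sum_elimination_weight (R : realFieldType) (I : finType) (c u : I -> R)
    (p : I * I) :
  \sum_i elimination_weight c p i * u i =
    if c p.1 == 0 then u p.1
    else if (0 < c p.1) && (c p.2 < 0)
    then c p.1 * u p.2 - c p.2 * u p.1
    else 0.
Proof.
rewrite /elimination_weight.
case: ifP => _; first exact: sum_delta.
case: ifP => _; last by rewrite big1 // => i _; rewrite mul0r.
rewrite -(sum_delta p.1 u) -(sum_delta p.2 u) !mulr_sumr -sumrB.
by apply: eq_bigr => i _; rewrite mulrBl !mulrA.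
Qed.

Lemma elimination_weight_ge0 (R : realFieldType) (I : finType) (c : I -> R)
    (p : I * I) (i : I) :
  0 <= elimination_weight c p i.
Proof.
rewrite /elimination_weight; case: ifP => // _; case: ifP => // /andP[cp cn].
by rewrite subr_ge0 (@le_trans _ _ 0) ?mulr_ge0 ?mulr_le0_ge0 // ltW.
Qed.

Lemma elimination_weight_cancel (R : realFieldType) (I : finType) (c : I -> R)
    (p : I * I) :
  \sum_i elimination_weight c p i * c i = 0.
Proof.
rewrite sum_elimination_weight; case: eqP => // _; case: ifP => // _.
by rewrite mulrC subrr.
Qed.

(** In the elimination step a solution of the reduced system extends by
    [one_unknown_system] to one of the full system, and a certificate [y] of the
    reduced system pulls back to [y *m W], where [W] is the nonnegative matrix of
    elimination weights. *)
Lemma gale_alternative (R : realFieldType) (k : nat) (I : finType)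
    (a : I -> 'I_k -> R) (b : I -> R) :
  (exists x : 'I_k -> R, forall i, \sum_l a i l * x l <= b i) \/
  (exists y : I -> R, [/\ forall i, 0 <= y i,
     forall l, \sum_i y i * a i l = 0 & \sum_i y i * b i < 0]).
Proof.
elim: k I a b => [|k IHk] I a b.
  have [b_ge0|/existsNP[i /negP]] := pselect (forall i, 0 <= b i).
    by left; exists (fun=> 0) => i; rewrite big_ord0.
  rewrite -ltNge => bi; right; exists (fun j => (j == i)%:R).
  split=> [j||]; [exact: ler0n | by case | by rewrite sum_delta].
pose c i := a i ord0.
pose W := elimination_weight c.
have [[x' x'P]|[y' [y'_ge0 y'a y'b]]] :=
  IHk (I * I)%type (fun p l => \sum_i W p i * a i (lift ord0 l))
      (fun p => \sum_i W p i * b i).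
  left; pose r i := b i - \sum_l a i (lift ord0 l) * x' l.
  have Wr p : 0 <= \sum_i W p i * r i.
    suff -> : \sum_i W p i * r i = \sum_i W p i * b i -
        \sum_l (\sum_i W p i * a i (lift ord0 l)) * x' l.
      by rewrite subr_ge0.
    under [X in _ - X]eq_bigr do rewrite mulr_suml.
    rewrite exchange_big -sumrB; apply: eq_bigr => i _ /=.
    rewrite mulrBr mulr_sumr; congr (_ - _).
    by apply: eq_bigr => l _; rewrite mulrA.
  have [t tP] : exists t, forall i, c i * t <= r i.
    apply: one_unknown_system => [i ci|i j ci cj].
      by have := Wr (i, i); rewrite sum_elimination_weight /= ci eqxx.
    by have := Wr (i, j); rewrite sum_elimination_weight /= gt_eqF // ci cj.
  exists (fun l => oapp x' t (unlift ord0 l)) => i.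
  rewrite big_ord_recl unlift_none /=.
  under eq_bigr do rewrite liftK /=.
  by rewrite -lerBrDr; exact: tP.
right; pose y i := \sum_p y' p * W p i.
have yE (u : I -> R) :
    \sum_i y i * u i = \sum_p y' p * \sum_i W p i * u i.
  under eq_bigr do rewrite mulr_suml.
  rewrite exchange_big; apply: eq_bigr => p _ /=.
  by rewrite mulr_sumr; apply: eq_bigr => i _; rewrite mulrA.
exists y; split=> [i|l|]; last by rewrite yE.
  by apply: sumr_ge0 => p _; rewrite mulr_ge0 // elimination_weight_ge0.
rewrite yE; case: (unliftP ord0 l) => [l' ->|->]; first exact: y'a.
by apply: big1 => p _; rewrite elimination_weight_cancel mulr0.
Qed.

Lemma Jac_mul (R : realType) (s k : nat) (h : 'rV[R]_s -> 'rV[R]_k)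
    (x v : 'rV[R]_s) (i : 'I_k) :
  (Jac h x *m v^T)^T 0 i = dotv (grad h i x) v.
Proof.
by rewrite mxE mxE; apply: eq_bigr => l _; rewrite [v^T _ _]mxE [grad _ _ _ _ _]mxE.
Qed.

Lemma KT_equation_dotv (R : realType) (s n m : nat) (f : 'rV[R]_s -> 'rV[R]_n)
    (g : 'rV[R]_s -> 'rV[R]_m) (x v : 'rV[R]_s) (lam : 'rV[R]_n)
    (mu : 'rV[R]_m) :
  \sum_(i < n) lam 0 i *: grad f i x
    + \sum_(j in active g x) mu 0 j *: grad g j x = 0 ->
  \sum_(i < n) lam 0 i * dotv (grad f i x) v
    + \sum_(j in active g x) mu 0 j * dotv (grad g j x) v = 0.
Proof.
move=> KT.
have pairE (I : finType) (P : pred I) (w : I -> R) (u : I -> 'rV[R]_s) :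
    \sum_(i in P) w i * dotv (u i) v = dotv (\sum_(i in P) w i *: u i) v.
  rewrite /dotv; under eq_bigr do rewrite mulr_sumr.
  rewrite exchange_big; apply: eq_bigr => l _ /=.
  rewrite summxE mulr_suml.
  by apply: eq_bigr => i _; rewrite mxE mulrA.
have -> : \sum_(i < n) lam 0 i * dotv (grad f i x) v =
    dotv (\sum_(i < n) lam 0 i *: grad f i x) v by exact: (pairE _ predT).
rewrite pairE /dotv -big_split; apply: big1 => l _ /=.
have /matrixP/(_ 0 l) := KT; rewrite 2!mxE => KTl.
by rewrite -mulrDl KTl mul0r.
Qed.

Lemma dotvBr (R : realType) (k : nat) (a b c : 'rV[R]_k) :
  dotv a (b - c) = dotv a b - dotv a c.
Proof. by rewrite -sumrB; apply: eq_bigr => i _; rewrite !mxE mulrBr. Qed.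

Lemma KT_invex_weighting (R : realType) (s n m : nat) (X : set 'rV[R]_s)
    (f : 'rV[R]_s -> 'rV[R]_n) (g : 'rV[R]_s -> 'rV[R]_m) (x : 'rV[R]_s)
    (lam : 'rV[R]_n) (mu : 'rV[R]_m) :
  KT_invex X f g -> feasible X g x -> KT_conditions f g x lam mu ->
  weighting_global_solution X f g lam x.
Proof.
move=> [eta etaP] [Xx gx] [lam_ge0 _ mu_ge0 _ KT].
split=> // y [Xy gy]; rewrite -subr_ge0 -dotvBr.
have [f_eta g_eta] := etaP x y Xx Xy gx gy.
have := KT_equation_dotv (eta x y) KT.
move/eqP; rewrite addr_eq0 => /eqP lamE.
apply: (@le_trans _ _ (\sum_(i < n) lam 0 i * dotv (grad f i x) (eta x y))).
  rewrite lamE oppr_ge0; apply: sumr_le0 => j jx.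
  rewrite mulr_ge0_le0 //; last exact: g_eta.
  by have := mu_ge0 j; rewrite mxE.
apply: ler_sum => i _; apply: ler_wpM2l.
  by have := lam_ge0 i; rewrite mxE.
by rewrite -Jac_mul; exact: f_eta.
Qed.

(** Gale's alternative for the system that defines eta x y.  Inactive
    constraints enter as trivial inequalities 0 <= 0, so that all constraints
    can be indexed by ['I_m]; their multipliers are reset to 0 afterwards, as
    complementary slackness demands. *)
Lemma invex_direction (R : realType) (s n m : nat)
    (f : 'rV[R]_s -> 'rV[R]_n) (g : 'rV[R]_s -> 'rV[R]_m) (x y : 'rV[R]_s) :
  (forall lam mu, KT_conditions f g x lam mu ->
     dotv lam (f x) <= dotv lam (f y)) ->
  exists v : 'rV[R]_s, (Jac f x *m v^T)^T <=v f y - f x /\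
    forall j, j \in active g x -> dotv (grad g j x) v <= 0.
Proof.
move=> lam_opt.
pose a (i : 'I_n + 'I_m) (l : 'I_s) : R := match i with
  | inl i => grad f i x 0 l
  | inr j => if j \in active g x then grad g j x 0 l else 0 end.
pose b (i : 'I_n + 'I_m) : R := if i is inl i then (f y - f x) 0 i else 0.
have [[v vP]|[w [w_ge0 wa wb]]] := gale_alternative a b.
  exists (\row_l v l); split=> [i|j jx].
    rewrite Jac_mul /dotv; under eq_bigr do rewrite [X in _ * X]mxE.
    exact: vP (inl i).
  rewrite /dotv; under eq_bigr do rewrite [X in _ * X]mxE.
  by have := vP (inr j); rewrite /a jx.
pose lam := \row_i w (inl i).
pose mu := \row_j (if j \in active g x then w (inr j) else 0).
have lam_lt0 : dotv lam (f y - f x) < 0.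
  move: wb; rewrite big_sumType /= [X in _ + X]big1 ?addr0; last first.
    by move=> j _; rewrite mulr0.
  by congr (_ < 0); apply: eq_bigr => i _; rewrite [in RHS]mxE.
suff /lam_opt : KT_conditions f g x lam mu.
  by rewrite -subr_ge0 -dotvBr leNgt lam_lt0.
split.
- by move=> i; rewrite !mxE.
- move=> lam0; move: lam_lt0; rewrite lam0 /dotv big1 ?ltxx // => i _.
  by rewrite mxE mul0r.
- by move=> j; rewrite !mxE; case: ifP.
- move=> j; rewrite mxE; case: ifP => [|_]; last by rewrite mul0r.
  by rewrite inE => /eqP ->; rewrite mulr0.
- apply/rowP => l; rewrite [RHS]mxE -[RHS](wa l) big_sumType mxE !summxE /=.
  congr (_ + _); first by apply: eq_bigr => i _; rewrite mxE [lam _ _]mxE.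
  rewrite big_mkcond; apply: eq_bigr => j _; rewrite /a.
  case: ifP => jx; last by rewrite mulr0.
  by rewrite mxE [mu _ _]mxE jx.
Qed.

Theorem theorem4 (R : realType) (s n m : nat) (X : set 'rV[R]_s)
    (f : 'rV[R]_s -> 'rV[R]_n) (g : 'rV[R]_s -> 'rV[R]_m)
    (openX : open X)
    (diff_f : forall x, X x -> differentiable f x)
    (diff_g : forall x, X x -> differentiable g x) :
  (forall x, KT_point X f g x ->
     forall (lam : 'rV[R]_n) (mu : 'rV[R]_m),
       KT_conditions f g x lam mu -> weighting_global_solution X f g lam x)
  <-> KT_invex X f g.
Proof.
split=> [KT_opt|invex x [x_feas _] lam mu]; last exact: KT_invex_weighting.
have dirP (p : 'rV[R]_s * 'rV[R]_s) : exists v : 'rV[R]_s,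
    feasible X g p.1 -> feasible X g p.2 ->
    (Jac f p.1 *m v^T)^T <=v f p.2 - f p.1 /\
    forall j, j \in active g p.1 -> dotv (grad g j p.1) v <= 0.
  case: p => x y /=.
  have [[x_feas y_feas]|nfeas] := pselect (feasible X g x /\ feasible X g y).
    have [v vP] : exists v : 'rV[R]_s, (Jac f x *m v^T)^T <=v f y - f x /\
        forall j, j \in active g x -> dotv (grad g j x) v <= 0.
      apply: invex_direction => lam mu KT.
      have x_KT : KT_point X f g x by split=> //; exists lam, mu.
      by have [_] := KT_opt x x_KT lam mu KT; apply.
    by exists v.
  by exists 0 => x_feas y_feas; case: nfeas.
have [eta etaP] := choice dirP.
by exists (fun x y => eta (x, y)) => x y Xx Xy gx gy; exact: (etaP (x, y)).
Qed.
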